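(* For all $x,y>0$ and all $p\in[0,1]\cup[2,\infty)$, $$M_1(x,y)^p\le\left(\frac{M_p(x,y)+M_{-p}(x,y)}{2}\right)^{p-1}M_p(x,y),$$ while the reverse inequality ($\ge$ in place of $\le$) is valid for all $x,y>0$ and all $p\in(-\infty,0)\cup(1,2)$.
   Context: For $x,y>0$ and $q\in\mathbb{R}$, the $q$th power mean is $M_q(x,y)=\left((x^q+y^q)/2\right)^{1/q}$ if $q\neq0$, and $M_0(x,y)=\sqrt{xy}$. *)

(* Defs.v *)
From Stdlib Require Import Reals.
Open Scope R_scope.

(* [Rpower x q] is the usual real power only for a positive base: [power_mean]
   is meant for [0 < x] and [0 < y]. *)
Definition power_mean (q x y : R) : R :=
  if Req_EM_T q 0 then sqrt (x * y)
  else Rpower ((Rpower x q + Rpower y q) / 2) (1 / q).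

(* Main.v *)
Require Import Defs.
From Stdlib Require Import Reals Lra Psatz.
From Coquelicot Require Import Coquelicot.
Open Scope R_scope.

(** Put [r = 1/p], [v = p (ln x - ln y) / 2] and [A = ln (cosh v)].  After taking
    logarithms the claim becomes a sign statement for
    [G = r^2 A + (1 - r) ln (cosh (r A)) - ln (cosh (r v))], an even function of
    [v] which vanishes at [0] and, for [r > 0], tends to [0] at infinity.  Hence
    it suffices that [G'], up to a sign depending on [r], is first nonnegative
    and then negative on [v > 0].

    The sign of [G'] is that of [1 - r] times the sign of
    [tanh (r A) - u], where [u] is affine in [tanh (r v) / tanh v]; it is also
    the sign of [K = r A - artanh u].  Again [K] vanishes at [0+], and [K'] is a
    positive multiple of a combination [N] of four hyperbolic sines, so it is
    enough to know the sign pattern of [N].  That is a Descartes rule: the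
    operators [d^2/dv^2 - a^2] remove the terms one at a time, and the pattern
    passes back through each of them because [N'(0) = 0] and [N'''(0)] is a
    positive multiple of [r (1 - r)^2 (1 - 2 r)].

    For [r < 0] a cruder inequality suffices, in which the analogue of [N] is
    visibly positive. *)

(** * Functions with one sign change, and their antiderivatives *)

(** Encodes at most one sign change on the positive axis, from nonnegative to negative, without
    naming the point of change; a constant sign is allowed. *)
Definition stays_negative (f : R -> R) : Prop :=
  forall a b, 0 < a < b -> f a < 0 -> f b < 0.

Lemma increasing_from_derive (g g' : R -> R) a b :
  a < b -> (forall c, a <= c <= b -> is_derive g c (g' c)) ->
  (forall c, a < c < b -> 0 <= g' c) -> g a <= g b.
Proof.
intros ab Hd Hp.
destruct (MVT_cor2 g g' a b ab) as [c [Hc Hcab]].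
{ intros c Hc; apply is_derive_Reals, Hd, Hc. }
generalize (Hp c Hcab); nra.
Qed.

Lemma strictly_increasing_from_derive (g g' : R -> R) a b :
  a < b -> (forall c, a <= c <= b -> is_derive g c (g' c)) ->
  (forall c, a < c < b -> 0 < g' c) -> g a < g b.
Proof.
intros ab Hd Hp.
destruct (MVT_cor2 g g' a b ab) as [c [Hc Hcab]].
{ intros c Hc; apply is_derive_Reals, Hd, Hc. }
generalize (Hp c Hcab); nra.
Qed.

(** Near [0] some value of [g] exceeds [g a < 0], so the mean value theorem gives [c < a] with
    [f c < 0], and [f] is negative from [c] on. The behaviour at [0+] is a one-sided bound because
    [log_gap] has no meaningful value at [0]. *)
Lemma decreasing_once_negative (g k f : R -> R) :
  (forall v, 0 < v -> is_derive g v (k v * f v)) ->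
  (forall v, 0 < v -> 0 < k v) ->
  (forall e, 0 < e -> exists d, 0 < d /\ forall v, 0 < v < d -> - e < g v) ->
  stays_negative f ->
  forall a b, 0 < a < b -> g a < 0 -> g b < g a.
Proof.
intros Hd Hk H0 Hf a b ab ga.
assert (Hxi : exists c, 0 < c < a /\ f c < 0).
{ destruct (H0 (- g a)) as [d [d0 Hd0]]; [lra|].
  set (x := Rmin (d / 2) (a / 2)).
  assert (Hx : 0 < x < d /\ x < a).
  { unfold x; generalize (Rmin_l (d/2) (a/2)) (Rmin_r (d/2) (a/2)).
    assert (0 < Rmin (d/2) (a/2)) by (apply Rmin_glb_lt; lra). lra. }
  destruct Hx as [Hx1 Hx2].
  specialize (Hd0 x Hx1).
  destruct (MVT_cor2 g (fun v => k v * f v) x a Hx2) as [c [Hc Hcab]].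
  { intros c Hc; apply is_derive_Reals, Hd; lra. }
  exists c; split; [lra|].
  assert (0 < k c) by (apply Hk; lra).
  destruct (Rlt_dec (f c) 0) as [|Hn]; auto.
  assert (0 <= k c * f c) by (apply Rmult_le_pos; lra). nra. }
destruct Hxi as [c [Hc fc]].
apply Ropp_lt_cancel.
apply (strictly_increasing_from_derive (fun v => - g v) (fun v => - (k v * f v))); [lra| |].
- intros t Ht; apply @is_derive_opp; apply Hd; lra.
- intros t Ht. assert (f t < 0) by (apply (Hf c t); lra).
  assert (0 < k t) by (apply Hk; lra). nra.
Qed.

Lemma stays_negative_integral (g k f : R -> R) :
  (forall v, 0 < v -> is_derive g v (k v * f v)) ->
  (forall v, 0 < v -> 0 < k v) ->
  (forall e, 0 < e -> exists d, 0 < d /\ forall v, 0 < v < d -> - e < g v) ->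
  stays_negative f -> stays_negative g.
Proof.
intros Hd Hk H0 Hf a b ab ga.
generalize (decreasing_once_negative g k f Hd Hk H0 Hf a b ab ga); lra.
Qed.

Lemma ge_near_0_of_continuous (g : R -> R) :
  continuous g 0 -> 0 <= g 0 ->
  forall e, 0 < e -> exists d, 0 < d /\ forall v, 0 < v < d -> - e < g v.
Proof.
intros Hc H0 e He.
destruct (proj1 (filterlim_locally g (g 0)) Hc (mkposreal e He)) as [d Hd].
exists d; split; [apply cond_pos|].
intros v Hv.
assert (Hb : ball 0 d v).
{ change (Rabs (v - 0) < d); rewrite Rabs_pos_eq; lra. }
specialize (Hd v Hb); change (Rabs (g v - g 0) < e) in Hd.
apply Rabs_def2 in Hd; lra.
Qed.

(* [d^2/dv^2 - a^2] factors as [(d/dv + a) (d/dv - a)], and each factor becomes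
   a plain derivative after multiplication by [exp (+-a v)]. *)
Lemma stays_negative_second_order (g g1 f : R -> R) a :
  (forall v, is_derive g v (g1 v)) ->
  (forall v, is_derive g1 v (f v + a ^ 2 * g v)) ->
  0 <= g 0 ->
  (0 <= g1 0 - a * g 0 \/ forall v, 0 < v -> f v < 0) ->
  stays_negative f -> stays_negative g.
Proof.
intros Dg Dg1 H0 H1 Hf.
assert (Dy : forall v, is_derive (fun v => exp (a * v) * (g1 v - a * g v)) v
   (exp (a * v) * f v)).
{ intros v. auto_derive.
  - repeat split; eexists; [apply Dg1|apply Dg].
  - replace (Derive (fun x => g x) v) with (g1 v) by (symmetry; apply is_derive_unique, Dg).
    replace (Derive (fun x => g1 x) v) with (f v + a^2 * g v) by (symmetry; apply is_derive_unique, Dg1).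
    ring. }
assert (Hy : stays_negative (fun v => exp (a * v) * (g1 v - a * g v))).
{ destruct H1 as [H1|H1].
  - apply (stays_negative_integral _ (fun v => exp (a * v)) f); auto.
    + intros; apply exp_pos.
    + apply ge_near_0_of_continuous.
      * apply (ex_derive_continuous (V:=R_NormedModule)). eexists; apply Dy.
      * rewrite Rmult_0_r, exp_0; lra.
  (* No initial value is known here; instead [f < 0] makes the function decreasing. *)
  - intros x y xy Hx.
    assert (- (exp (a * x) * (g1 x - a * g x)) < - (exp (a * y) * (g1 y - a * g y))); [|lra].
    apply (strictly_increasing_from_derive (fun v => - (exp (a * v) * (g1 v - a * g v))) (fun v => - (exp (a * v) * f v))); [lra| |].
    + intros c Hc; apply @is_derive_opp; apply Dy.
    + intros c Hc. assert (f c < 0) by (apply H1; lra).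
      generalize (exp_pos (a * c)); nra. }
(* The squared exponential is the positive weight that turns this derivative into a multiple of the
   function just treated. *)
assert (Dz : forall v, is_derive (fun v => exp (- a * v) * g v) v
   (exp (- a * v) ^ 2 * (exp (a * v) * (g1 v - a * g v)))).
{ intros v. auto_derive.
  - repeat split; eexists; apply Dg.
  - replace (Derive (fun x => g x) v) with (g1 v) by (symmetry; apply is_derive_unique, Dg).
    replace (exp (- a * v) ^ 2 * (exp (a * v) * (g1 v - a * g v)))
     with (exp (- a * v) * (exp (-a * v) * exp (a * v)) * (g1 v - a * g v)) by ring.
    rewrite <- exp_plus. replace (- a * v + a * v) with 0 by ring. rewrite exp_0; ring. }
assert (Hz : stays_negative (fun v => exp (- a * v) * g v)).
{ apply (stays_negative_integral _ (fun v => exp (- a * v) ^ 2) (fun v => exp (a * v) * (g1 v - a * g v))); auto.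
  - intros; apply pow_lt, exp_pos.
  - apply ge_near_0_of_continuous.
    + apply (ex_derive_continuous (V:=R_NormedModule)). eexists; apply Dz.
    + rewrite Rmult_0_r, exp_0; lra. }
intros x y xy gx.
assert (exp (- a * y) * g y < 0).
{ apply (Hz x y xy). generalize (exp_pos (- a * x)); nra. }
generalize (exp_pos (- a * y)); nra.
Qed.

(** * Descartes rule for sums of four hyperbolic sines *)

Definition sinh_sum (c1 a1 c2 a2 c3 a3 c4 a4 v : R) : R :=
  c1 * sinh (a1 * v) + c2 * sinh (a2 * v) + c3 * sinh (a3 * v)
  + c4 * sinh (a4 * v).

Lemma sinh_sum_0 c1 a1 c2 a2 c3 a3 c4 a4 :
  sinh_sum c1 a1 c2 a2 c3 a3 c4 a4 0 = 0.
Proof. unfold sinh_sum; rewrite !Rmult_0_r, sinh_0; ring. Qed.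

(** [d^2/dv^2 - a^2] multiplies [sinh (x v)] by [k x], so choosing [a] among the frequencies kills a
    term. The sum in the first alternative is the derivative at [0]. *)
Lemma stays_negative_sinh_sum_step c1 a1 c2 a2 c3 a3 c4 a4 a :
  let k x := x ^ 2 - a ^ 2 in
  let f := sinh_sum (c1 * k a1) a1 (c2 * k a2) a2 (c3 * k a3) a3 (c4 * k a4) a4 in
  (0 <= c1 * a1 + c2 * a2 + c3 * a3 + c4 * a4 \/ forall v, 0 < v -> f v < 0) ->
  stays_negative f -> stays_negative (sinh_sum c1 a1 c2 a2 c3 a3 c4 a4).
Proof.
intros k f H Hf.
apply (stays_negative_second_order _ (fun v => c1 * a1 * cosh (a1 * v) + c2 * a2 * cosh (a2 * v) + c3 * a3 * cosh (a3 * v) + c4 * a4 * cosh (a4 * v)) f a); auto.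
- intros v; unfold sinh_sum, sinh, cosh; auto_derive; [easy|field].
- intros v; unfold f, k, sinh_sum, sinh, cosh; auto_derive; [easy|field].
- rewrite sinh_sum_0; lra.
- destruct H as [H|H]; [left|now right].
  rewrite sinh_sum_0, !Rmult_0_r, cosh_0; lra.
Qed.

Lemma sinh_pos v : 0 < v -> 0 < sinh v.
Proof. intros; rewrite <- sinh_0; now apply sinh_lt. Qed.

(** Removing the frequencies [a1], [a2], [a3] leaves a negative multiple of [sinh (a4 v)]. The two
    moment hypotheses concern the first and third derivatives at [0] and supply the initial values
    for the first two removals; the third uses negativity of what remains. *)
Lemma stays_negative_sinh_sum c1 a1 c2 a2 c3 a3 c4 a4 :
  c4 < 0 -> 0 < a4 -> a1 ^ 2 < a4 ^ 2 -> a2 ^ 2 < a4 ^ 2 -> a3 ^ 2 < a4 ^ 2 ->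
  c1 * a1 + c2 * a2 + c3 * a3 + c4 * a4 = 0 ->
  0 <= c1 * a1 ^ 3 + c2 * a2 ^ 3 + c3 * a3 ^ 3 + c4 * a4 ^ 3 ->
  stays_negative (sinh_sum c1 a1 c2 a2 c3 a3 c4 a4).
Proof.
intros Hc Ha H1 H2 H3 M1 M3.
apply (stays_negative_sinh_sum_step _ _ _ _ _ _ _ _ a1); [left; lra|].
apply (stays_negative_sinh_sum_step _ _ _ _ _ _ _ _ a2).
{ left.
  replace (_ + _) with (c1 * a1 ^ 3 + c2 * a2 ^ 3 + c3 * a3 ^ 3 + c4 * a4 ^ 3
    - a1 ^ 2 * (c1 * a1 + c2 * a2 + c3 * a3 + c4 * a4)) by ring.
  rewrite M1; lra. }
assert (Hneg : forall v, 0 < v -> sinh_sum 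
    (c1 * (a1 ^ 2 - a1 ^ 2) * (a1 ^ 2 - a2 ^ 2) * (a1 ^ 2 - a3 ^ 2)) a1
    (c2 * (a2 ^ 2 - a1 ^ 2) * (a2 ^ 2 - a2 ^ 2) * (a2 ^ 2 - a3 ^ 2)) a2
    (c3 * (a3 ^ 2 - a1 ^ 2) * (a3 ^ 2 - a2 ^ 2) * (a3 ^ 2 - a3 ^ 2)) a3
    (c4 * (a4 ^ 2 - a1 ^ 2) * (a4 ^ 2 - a2 ^ 2) * (a4 ^ 2 - a3 ^ 2)) a4 v < 0).
{ intros v Hv; unfold sinh_sum.
  assert (0 < sinh (a4 * v)) by (apply sinh_pos, Rmult_lt_0_compat; lra).
  assert (0 < (a4 ^ 2 - a1 ^ 2) * (a4 ^ 2 - a2 ^ 2) * (a4 ^ 2 - a3 ^ 2) * sinh (a4 * v))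
    by (apply Rmult_lt_0_compat; [repeat apply Rmult_lt_0_compat; lra | easy]).
  match goal with |- ?l < 0 => replace l with
   (c4 * ((a4 ^ 2 - a1 ^ 2) * (a4 ^ 2 - a2 ^ 2) * (a4 ^ 2 - a3 ^ 2) * sinh (a4 * v))) by ring end.
  nra. }
apply (stays_negative_sinh_sum_step _ _ _ _ _ _ _ _ a3).
- right; exact Hneg.
- intros a b ab _; apply Hneg; lra.
Qed.

(** * The sign pattern of [N] *)

(* Numerator of the derivative of [log_gap], see [is_derive_log_gap]. *)
Definition gap_numerator (r v : R) : R :=
  let t := tanh v in let h := tanh (r * v) in
  (1 - r) * (h - r * t) - (1 - 2 * r) * (1 + r) * h * t ^ 2
  + r * (1 - 2 * r) * t ^ 3 - r ^ 2 * t * h ^ 2.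

Lemma cosh_pos v : 0 < cosh v.
Proof. unfold cosh; generalize (exp_pos v) (exp_pos (-v)); lra. Qed.

Lemma gap_weight_pos r v : 0 < 4 * cosh v ^ 3 * cosh (r * v) ^ 2.
Proof.
apply Rmult_lt_0_compat; [apply Rmult_lt_0_compat; [lra|]|];
  apply pow_lt, cosh_pos.
Qed.

(** The weight clears the denominators of [tanh v] and [tanh (r v)]. In [X = exp v] and
    [Y = exp (r v)] both sides are rational functions. *)
Lemma gap_numerator_sinh_sum r v :
  4 * cosh v ^ 3 * cosh (r * v) ^ 2 * gap_numerator r v =
  sinh_sum ((1 - r) ^ 2) (1 + 2 * r) (- (1 - 2 * r ^ 2)) (1 - 2 * r)
    (- (2 * r * (1 - 2 * r))) 1 (- r ^ 2) (3 - 2 * r) v.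
Proof.
unfold gap_numerator, tanh, sinh_sum.
generalize (cosh_pos v) (cosh_pos (r * v)).
unfold cosh, sinh.
rewrite !exp_Ropp.
replace ((1 + 2 * r) * v) with (v + (r * v + r * v)) by ring.
replace ((1 - 2 * r) * v) with (v + - (r * v + r * v)) by ring.
replace ((3 - 2 * r) * v) with (v + (v + v) + - (r * v + r * v)) by ring.
rewrite Rmult_1_l, !exp_plus, !exp_Ropp, !exp_plus.
generalize (exp_pos v) (exp_pos (r * v)).
generalize (exp v) (exp (r * v)); intros X Y HX HY H1 H2.
assert (X * X + 1 <> 0) by nra. assert (Y * Y + 1 <> 0) by nra.
field; repeat split; try lra; nra.
Qed.

Lemma stays_negative_gap_numerator r :
  0 < r <= / 2 -> stays_negative (gap_numerator r).
Proof.
intros Hr.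
assert (HN : stays_negative (sinh_sum ((1 - r) ^ 2) (1 + 2 * r) (- (1 - 2 * r ^ 2)) (1 - 2 * r)
    (- (2 * r * (1 - 2 * r))) 1 (- r ^ 2) (3 - 2 * r))).
{ destruct (Req_dec r (/ 2)) as [E|E].
  (* At [r = 1/2] the frequencies [1 + 2 r] and [3 - 2 r] coincide, so none dominates strictly; but
     then the whole sum vanishes. *)
  - intros a b _. subst r; unfold sinh_sum.
    replace (3 - 2 * / 2) with 2 by field. replace (1 + 2 * / 2) with 2 by field.
    replace (1 - 2 * / 2) with 0 by field. rewrite Rmult_0_l, sinh_0; lra.
  - apply stays_negative_sinh_sum; try nra.
    match goal with |- 0 <= ?l => replace l with (8 * r * (1 - r) ^ 2 * (1 - 2 * r)) by ring end.
    apply Rmult_le_pos; [apply Rmult_le_pos; [lra|apply pow2_ge_0]|lra]. }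
intros a b ab; generalize (HN a b ab).
rewrite <- !gap_numerator_sinh_sum.
generalize (gap_weight_pos r a) (gap_weight_pos r b); intros Pa Pb H Ha.
assert (4 * cosh b ^ 3 * cosh (r * b) ^ 2 * gap_numerator r b < 0) by (apply H; nra).
nra.
Qed.

(** Beyond [r = 1/2] the largest frequency is [1 + 2 r], whose coefficient in [N] is positive when
    [r <> 1]; hence the change of sign and the reordering of the terms. *)
Lemma stays_negative_opp_gap_numerator r :
  / 2 < r -> r <> 1 -> stays_negative (fun v => - gap_numerator r v).
Proof.
intros Hr Hr1.
assert (HN : stays_negative (sinh_sum (r ^ 2) (3 - 2 * r) (1 - 2 * r ^ 2) (1 - 2 * r)
    (2 * r * (1 - 2 * r)) 1 (- (1 - r) ^ 2) (1 + 2 * r))).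
{ assert (0 < (1 - r) ^ 2) by (apply pow2_gt_0; lra).
  apply stays_negative_sinh_sum; try nra.
  match goal with |- 0 <= ?l => replace l with (8 * r * (1 - r) ^ 2 * (2 * r - 1)) by ring end.
  apply Rmult_le_pos; [apply Rmult_le_pos|]; lra. }
intros a b ab; generalize (HN a b ab).
assert (E : forall v, sinh_sum (r ^ 2) (3 - 2 * r) (1 - 2 * r ^ 2) (1 - 2 * r)
    (2 * r * (1 - 2 * r)) 1 (- (1 - r) ^ 2) (1 + 2 * r) v
   = - (4 * cosh v ^ 3 * cosh (r * v) ^ 2 * gap_numerator r v))
 by (intros v; rewrite gap_numerator_sinh_sum; unfold sinh_sum; ring).
rewrite !E.
generalize (gap_weight_pos r a) (gap_weight_pos r b); intros Pa Pb H Ha.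
assert (- (4 * cosh b ^ 3 * cosh (r * b) ^ 2 * gap_numerator r b) < 0) by (apply H; nra).
nra.
Qed.

(** * Derivatives and comparisons for the hyperbolic tangent *)

Lemma is_derive_tanh_scale a v :
  is_derive (fun v => tanh (a * v)) v (a * (1 - tanh (a * v) ^ 2)).
Proof.
generalize (cosh_pos (a * v)); unfold tanh, sinh, cosh; intros Hc.
auto_derive; [lra|].
rewrite exp_Ropp in *. generalize (exp_pos (a * v)).
revert Hc; generalize (exp (a * v)); intros X Hc HX.
assert (X * X + 1 <> 0) by nra.
field; repeat split; try lra; nra.
Qed.

Lemma is_derive_tanh v : is_derive tanh v (1 - tanh v ^ 2).
Proof.
apply (is_derive_ext (fun v => tanh (1 * v))).
{ intros t; now rewrite Rmult_1_l. }
generalize (is_derive_tanh_scale 1 v). now rewrite !Rmult_1_l.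
Qed.

Lemma is_derive_ln_cosh v : is_derive (fun v => ln (cosh v)) v (tanh v).
Proof.
generalize (cosh_pos v); unfold tanh, cosh, sinh; intros.
auto_derive; [lra|field; lra].
Qed.

Lemma is_derive_ln_cosh_scale a v :
  is_derive (fun v => ln (cosh (a * v))) v (a * tanh (a * v)).
Proof.
apply (is_derive_comp (fun v => ln (cosh v)) (fun v => a * v)).
- apply is_derive_ln_cosh.
- auto_derive; [easy|ring].
Qed.

Lemma is_derive_ln_cosh_comp a v :
  is_derive (fun v => ln (cosh (a * ln (cosh v)))) v
    (tanh v * (a * tanh (a * ln (cosh v)))).
Proof.
apply (is_derive_comp (fun v => ln (cosh (a * v))) (fun v => ln (cosh v))).
- apply is_derive_ln_cosh_scale.
- apply is_derive_ln_cosh.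
Qed.

Lemma tanh_sqr_lt_1 v : tanh v ^ 2 < 1.
Proof.
generalize (cosh_pos v) (exp_pos v) (exp_pos (- v)); intros Hc H1 H2.
unfold tanh. unfold Rdiv; rewrite Rpow_mult_distr, pow_inv.
apply (Rmult_lt_reg_r (cosh v ^ 2)); [now apply pow_lt|].
rewrite Rmult_assoc, Rinv_l by (apply pow_nonzero; lra).
unfold cosh, sinh; nra.
Qed.

Lemma tanh_0 : tanh 0 = 0.
Proof. unfold tanh; rewrite sinh_0; lra. Qed.

Lemma tanh_lt a b : a < b -> tanh a < tanh b.
Proof.
intros ab.
apply (strictly_increasing_from_derive tanh (fun v => 1 - tanh v ^ 2)); auto.
- intros; apply is_derive_tanh.
- intros c _; generalize (tanh_sqr_lt_1 c); lra.
Qed.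

Lemma tanh_pos v : 0 < v -> 0 < tanh v.
Proof. intros; rewrite <- tanh_0; now apply tanh_lt. Qed.

(** The difference has derivative [r (tanh^2 v - tanh^2 (r v))], positive because [tanh]
    increases. *)
Lemma tanh_scale_gt r v : 0 < r < 1 -> 0 < v -> r * tanh v < tanh (r * v).
Proof.
intros Hr Hv.
assert (tanh (r * 0) - r * tanh 0 < tanh (r * v) - r * tanh v);
  [|rewrite Rmult_0_r, tanh_0 in *; lra].
apply (strictly_increasing_from_derive (fun v => tanh (r * v) - r * tanh v)
  (fun v => r * (1 - tanh (r * v) ^ 2) - r * (1 - tanh v ^ 2))); auto.
- intros c _; apply @is_derive_minus; [apply is_derive_tanh_scale|].
  apply is_derive_scal, is_derive_tanh.
- intros c Hc.
  assert (0 < tanh (r * c)) by (apply tanh_pos, Rmult_lt_0_compat; lra).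
  assert (tanh (r * c) < tanh c) by (apply tanh_lt; nra).
  assert (tanh (r * c) ^ 2 < tanh c ^ 2) by nra.
  nra.
Qed.

Lemma tanh_scale_lt r v : 1 < r -> 0 < v -> tanh (r * v) < r * tanh v.
Proof.
intros Hr Hv.
assert (H : / r * tanh (r * v) < tanh (/ r * (r * v))).
{ apply tanh_scale_gt; [|nra]. split; [apply Rinv_0_lt_compat; lra|].
  rewrite <- Rinv_1; apply Rinv_lt_contravar; lra. }
rewrite <- Rmult_assoc, Rinv_l, Rmult_1_l in H by lra.
apply (Rmult_lt_compat_l r) in H; [|lra].
rewrite <- Rmult_assoc, Rinv_r, Rmult_1_l in H by lra. exact H.
Qed.

(** * The function [K] and its derivative *)

(* Affine in [tanh (r v) / tanh v], which lies strictly between [r] and [1]. *)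
Definition tanh_gap (r v : R) : R := (tanh (r * v) / tanh v - r) / (1 - r).

(** The affine map sends [r] to [0] and [1] to [1], whichever of the two is larger. *)
Lemma tanh_gap_bounds r v : 0 < r -> r <> 1 -> 0 < v -> 0 < tanh_gap r v < 1.
Proof.
intros Hr Hr1 Hv; unfold tanh_gap.
assert (Ht := tanh_pos v Hv).
assert (Hw : tanh (r * v) / tanh v * tanh v = tanh (r * v)) by (field; lra).
set (w := tanh (r * v) / tanh v) in *.
set (u := (w - r) / (1 - r)).
assert (Hu : u * (1 - r) = w - r) by (unfold u; field; lra).
destruct (Rlt_dec r 1) as [H|H].
- assert (r * tanh v < tanh (r * v)) by (apply tanh_scale_gt; lra).
  assert (tanh (r * v) < tanh v) by (apply tanh_lt; nra).
  assert (r < w < 1) by nra. nra.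
- assert (tanh (r * v) < r * tanh v) by (apply tanh_scale_lt; lra).
  assert (tanh v < tanh (r * v)) by (apply tanh_lt; nra).
  assert (1 < w < r) by nra. nra.
Qed.

(* Twice [r * ln (cosh v) - artanh (u v)]. *)
Definition artanh_gap (r : R) (u : R -> R) (v : R) : R :=
  2 * r * ln (cosh v) - ln (1 + u v) + ln (1 - u v).

(** [u] stays arbitrary because it is [tanh_gap r] for positive [r], and a cruder function in the
    argument for negative [r]. *)
Lemma is_derive_artanh_gap r (u : R -> R) v u1 :
  is_derive u v u1 -> 0 < u v < 1 ->
  is_derive (artanh_gap r u) v (2 * r * tanh v - 2 * u1 / (1 - u v ^ 2)).
Proof.
intros Du Hu.
assert (D : forall f : R -> R, is_derive f v (tanh v) ->
  is_derive (fun v => 2 * r * f v - ln (1 + u v) + ln (1 - u v)) v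
    (2 * r * tanh v - 2 * u1 / (1 - u v ^ 2))).
{ intros f Df; auto_derive.
  - repeat split; try lra; eexists; first [apply Df | apply Du].
  - replace (Derive (fun x => f x) v) with (tanh v)
      by (symmetry; apply is_derive_unique, Df).
    replace (Derive (fun x => u x) v) with u1
      by (symmetry; apply is_derive_unique, Du).
    field; nra. }
exact (D (fun v => ln (cosh v)) (is_derive_ln_cosh v)).
Qed.

Lemma tanh_artanh u : -1 < u < 1 -> tanh ((ln (1 + u) - ln (1 - u)) / 2) = u.
Proof.
intros Hu. set (a := (ln (1 + u) - ln (1 - u)) / 2).
assert (Ha : exp a * exp a * (1 - u) = 1 + u).
{ rewrite <- exp_plus. rewrite <- (exp_ln (1 - u)) at 1 by lra.
  rewrite <- exp_plus, <- (exp_ln (1 + u)) at 1 by lra.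
  f_equal; unfold a; field. }
unfold tanh, sinh, cosh; rewrite exp_Ropp.
assert (HX := exp_pos a); revert HX Ha; generalize (exp a); intros X HX Ha.
assert (X * X + 1 <> 0) by nra.
replace (_ / _) with ((X * X - 1) / (X * X + 1)) by (field; repeat split; nra).
apply (Rmult_eq_reg_r (X * X + 1)); auto.
unfold Rdiv; rewrite Rmult_assoc, Rinv_l by auto. nra.
Qed.

(** The gap is [2 (r ln (cosh v) - a)] with [tanh a = u v], and [tanh] is strictly increasing. *)
Lemma artanh_gap_sign r (u : R -> R) v : -1 < u v < 1 ->
  (artanh_gap r u v < 0 <-> tanh (r * ln (cosh v)) < u v) /\
  (0 < artanh_gap r u v <-> u v < tanh (r * ln (cosh v))).
Proof.
intros Hu; unfold artanh_gap.
rewrite <- (tanh_artanh (u v) Hu) at 3 6.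
set (a := (ln (1 + u v) - ln (1 - u v)) / 2).
assert (Ha : ln (1 + u v) = 2 * a + ln (1 - u v)) by (unfold a; field).
rewrite Ha.
destruct (Rtotal_order (r * ln (cosh v)) a) as [H|[H|H]].
- generalize (tanh_lt _ _ H); lra.
- rewrite H; lra.
- generalize (tanh_lt _ _ H); lra.
Qed.

(** Twice the [K] of the overview. *)
Definition log_gap (r : R) : R -> R := artanh_gap r (tanh_gap r).

Lemma is_derive_tanh_gap r v : 0 < v -> r <> 1 ->
  is_derive (tanh_gap r) v
    ((r * (1 - tanh (r * v) ^ 2) * tanh v - tanh (r * v) * (1 - tanh v ^ 2))
     / tanh v ^ 2 / (1 - r)).
Proof.
intros Hv Hr.
assert (Ht := tanh_pos v Hv).
assert (D1 := is_derive_tanh v). assert (D2 := is_derive_tanh_scale r v).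
unfold tanh_gap.
assert (D3 := is_derive_div _ _ _ _ _ D2 D1 (Rgt_not_eq _ _ Ht)).
apply (is_derive_ext (fun v => / (1 - r) * (tanh (r * v) / tanh v - r))).
{ intros t; apply Rmult_comm. }
replace (_ / (1 - r)) with (/ (1 - r) * ((r * (1 - tanh (r * v) ^ 2) * tanh v - tanh (r * v) * (1 - tanh v ^ 2)) / tanh v ^ 2 - 0)) by (field; lra).
apply is_derive_scal.
apply @is_derive_minus; [|apply @is_derive_const].
exact D3.
Qed.

Lemma is_derive_log_gap r v : 0 < r -> r <> 1 -> 0 < v ->
  is_derive (log_gap r) v
    (2 / ((1 - r) ^ 2 * (1 - tanh_gap r v ^ 2) * tanh v ^ 2) * gap_numerator r v).
Proof.
intros Hr Hr1 Hv.
assert (Hu := tanh_gap_bounds r v Hr Hr1 Hv).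
assert (Ht := tanh_pos v Hv).
assert (Du := is_derive_tanh_gap r v Hv Hr1).
set (u' := _ / _) in Du.
assert (D := is_derive_artanh_gap r _ _ _ Du Hu).
replace (2 / _ * _) with (2 * r * tanh v - 2 * u' / (1 - tanh_gap r v ^ 2)); [exact D|].
assert (Hq : 1 - tanh_gap r v ^ 2 <> 0) by nra.
apply (Rmult_eq_reg_r ((1 - tanh_gap r v ^ 2) * (1 - r) ^ 2 * tanh v ^ 2)).
2: { apply Rmult_integral_contrapositive_currified; [|apply pow_nonzero; lra].
  apply Rmult_integral_contrapositive_currified; [easy|apply pow_nonzero; lra]. }
replace (2 / ((1 - r) ^ 2 * (1 - tanh_gap r v ^ 2) * tanh v ^ 2) * gap_numerator r v *
((1 - tanh_gap r v ^ 2) * (1 - r) ^ 2 * tanh v ^ 2)) with (2 * gap_numerator r v)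
 by (field; repeat split; lra).
replace ((2 * r * tanh v - 2 * u' / (1 - tanh_gap r v ^ 2)) *
((1 - tanh_gap r v ^ 2) * (1 - r) ^ 2 * tanh v ^ 2)) with
 ((2 * r * tanh v * (1 - tanh_gap r v ^ 2) - 2 * u') * (1 - r) ^ 2 * tanh v ^ 2) by (field; lra).
unfold u', tanh_gap, gap_numerator.
field; lra.
Qed.

(** * Behaviour of [K] near [0] and its sign pattern *)

Lemma le_sinh v : 0 <= v -> v <= sinh v.
Proof.
intros [Hv|<-]; [|rewrite sinh_0; lra].
assert (sinh 0 - 0 <= sinh v - v); [|rewrite sinh_0 in *; lra].
apply (increasing_from_derive (fun v => sinh v - v) (fun v => cosh v - 1)); auto.
- intros c _; unfold sinh, cosh; auto_derive; [easy|field].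
- intros c _; unfold cosh. generalize (exp_ineq1_le c) (exp_ineq1_le (- c)); lra.
Qed.

Lemma tanh_le v : 0 <= v -> tanh v <= v.
Proof.
intros [Hv|<-]; [|rewrite tanh_0; lra].
assert (0 - tanh 0 <= v - tanh v); [|rewrite tanh_0 in *; lra].
apply (increasing_from_derive (fun v => v - tanh v) (fun v => 1 - (1 - tanh v ^ 2))); auto.
- intros c _; apply @is_derive_minus; [apply @is_derive_id|apply is_derive_tanh].
- intros c _; nra.
Qed.

Lemma cosh_ge_1 v : 1 <= cosh v.
Proof. unfold cosh. generalize (exp_ineq1_le v) (exp_ineq1_le (- v)); lra. Qed.

Lemma ln_cosh_ge_0 v : 0 <= ln (cosh v).
Proof. rewrite <- ln_1; apply ln_le; [lra|apply cosh_ge_1]. Qed.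

Lemma ln_cosh_0 : ln (cosh 0) = 0.
Proof. now rewrite cosh_0, ln_1. Qed.

(** [tanh (r v) <= r v <= r sinh v = r cosh v tanh v]. *)
Lemma tanh_ratio_le r v : 0 < r -> 0 < v -> tanh (r * v) / tanh v <= r * cosh v.
Proof.
intros Hr Hv.
assert (Ht := tanh_pos v Hv).
apply (Rmult_le_reg_r (tanh v)); auto.
replace (tanh (r * v) / tanh v * tanh v) with (tanh (r * v)) by (field; lra).
apply (Rle_trans _ (r * v)); [apply tanh_le; nra|].
unfold tanh; replace (r * cosh v * (sinh v / cosh v)) with (r * sinh v)
  by (field; generalize (cosh_pos v); lra).
apply Rmult_le_compat_l; [lra|]. apply le_sinh; lra.
Qed.

(** The bound on the quotient gives [r / (1 - r)] times [cosh v - 1], and [r / (1 - r) <= 1] exactly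
    when [r <= 1/2]. *)
Lemma tanh_gap_le r v : 0 < r <= / 2 -> 0 < v -> tanh_gap r v <= cosh v - 1.
Proof.
intros Hr Hv; unfold tanh_gap.
assert (Hw := tanh_ratio_le r v (proj1 Hr) Hv).
apply (Rmult_le_reg_r (1 - r)); [lra|].
unfold Rdiv at 1; rewrite Rmult_assoc, Rinv_l by lra.
generalize (cosh_ge_1 v); nra.
Qed.

(** The gap is at least [ln (2 - cosh v) - ln (cosh v)], which is continuous and vanishes at [0]. *)
Lemma artanh_gap_near_0 r (u : R -> R) :
  0 < r -> (forall v, 0 < v -> 0 < u v < 1 /\ u v <= cosh v - 1) ->
  forall e, 0 < e ->
  exists d, 0 < d /\ forall v, 0 < v < d -> - e < artanh_gap r u v.
Proof.
intros Hr Hu e He.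
destruct (ge_near_0_of_continuous (fun v => ln (2 - cosh v) - ln (cosh v))) with (e := e)
  as [d [Hd H]]; auto.
{ apply (ex_derive_continuous (V:=R_NormedModule)).
  unfold cosh; auto_derive. rewrite Ropp_0, exp_0; lra. }
{ rewrite cosh_0. replace (2 - 1) with 1 by ring. rewrite ln_1; lra. }
(* Ensures [cosh v < 2], so that [ln (2 - cosh v)] is a genuine logarithm. *)
destruct (ge_near_0_of_continuous (fun v => 1 - cosh v)) with (e := 1)
  as [d' [Hd' H']]; [| |lra|].
{ apply (ex_derive_continuous (V:=R_NormedModule)).
  unfold cosh; auto_derive; easy. }
{ rewrite cosh_0; lra. }
exists (Rmin d d'); split; [now apply Rmin_glb_lt|].
intros v Hv.
assert (Hv1 : 0 < v < d) by (generalize (Rmin_l d d'); lra).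
assert (Hv2 : 0 < v < d') by (generalize (Rmin_r d d'); lra).
specialize (H v Hv1); specialize (H' v Hv2); simpl in H, H'.
destruct (Hu v (proj1 Hv)) as [Hu1 Hu2].
unfold artanh_gap.
assert (ln (1 + u v) <= ln (cosh v)) by (apply ln_le; lra).
assert (ln (2 - cosh v) <= ln (1 - u v)) by (apply ln_le; lra).
generalize (ln_cosh_ge_0 v); nra.
Qed.

Lemma log_gap_weight_pos r v : 0 < r -> r <> 1 -> 0 < v ->
  0 < 2 / ((1 - r) ^ 2 * (1 - tanh_gap r v ^ 2) * tanh v ^ 2).
Proof.
intros Hr Hr1 Hv.
assert (Hu := tanh_gap_bounds r v Hr Hr1 Hv).
apply Rdiv_lt_0_compat; [lra|].
apply Rmult_lt_0_compat; [apply Rmult_lt_0_compat; [|nra]|].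
- apply pow2_gt_0; lra.
- apply pow_lt, tanh_pos, Hv.
Qed.

Lemma stays_negative_log_gap r : 0 < r <= / 2 -> stays_negative (log_gap r).
Proof.
intros Hr.
apply (stays_negative_integral _ (fun v => 2 / ((1 - r) ^ 2 * (1 - tanh_gap r v ^ 2) * tanh v ^ 2)) (gap_numerator r)).
- intros v Hv; apply is_derive_log_gap; lra.
- intros v Hv; apply log_gap_weight_pos; lra.
- apply artanh_gap_near_0; [lra|].
  intros v Hv; split; [apply tanh_gap_bounds; lra|now apply tanh_gap_le].
- now apply stays_negative_gap_numerator.
Qed.

Lemma stays_negative_opp_log_gap r :
  / 2 < r -> r <> 1 -> stays_negative (fun v => - log_gap r v).
Proof.
intros Hr Hr1.
apply (stays_negative_integral _ (fun v => 2 / ((1 - r) ^ 2 * (1 - tanh_gap r v ^ 2) * tanh v ^ 2)) (fun v => - gap_numerator r v)).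
- intros v Hv. rewrite Ropp_mult_distr_r_reverse. apply @is_derive_opp, is_derive_log_gap; lra.
- intros v Hv; apply log_gap_weight_pos; lra.
(* With this sign, [0 < u < 1] makes the two logarithms contribute a nonnegative amount, so
   [- 2 r ln (cosh v)] is a lower bound. *)
- intros e He.
  destruct (ge_near_0_of_continuous (fun v => - (2 * r * ln (cosh v)))) with (e := e)
    as [d [Hd H]]; auto.
  { apply (ex_derive_continuous (V:=R_NormedModule)).
    unfold cosh; auto_derive. rewrite Ropp_0, exp_0; lra. }
  { rewrite ln_cosh_0; lra. }
  exists d; split; auto. intros v Hv; specialize (H v Hv); simpl in H.
  assert (Hu : 0 < tanh_gap r v < 1) by (apply tanh_gap_bounds; lra).
  unfold log_gap, artanh_gap.
  assert (ln (1 - tanh_gap r v) <= ln (1 + tanh_gap r v)) by (apply ln_le; lra). lra.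
- now apply stays_negative_opp_gap_numerator.
Qed.

(** * The function [G]: derivative and limit at infinity *)

(** The [G] of the overview: [p] times its value at [r = 1/p] is the difference of the logarithms of
    the two sides. *)
Definition mean_gap (r v : R) : R :=
  r ^ 2 * ln (cosh v) + (1 - r) * ln (cosh (r * ln (cosh v))) - ln (cosh (r * v)).

Lemma is_derive_mean_gap r v :
  is_derive (mean_gap r) v
    (r ^ 2 * tanh v + (1 - r) * (tanh v * (r * tanh (r * ln (cosh v))))
     - r * tanh (r * v)).
Proof.
apply @is_derive_minus; [apply @is_derive_plus|].
- apply is_derive_scal, is_derive_ln_cosh.
- apply is_derive_scal, is_derive_ln_cosh_comp.
- apply is_derive_ln_cosh_scale.
Qed.

Lemma is_derive_mean_gap_factored r v : r <> 1 -> 0 < v ->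
  is_derive (mean_gap r) v
    (r * tanh v * ((1 - r) * (tanh (r * ln (cosh v)) - tanh_gap r v))).
Proof.
intros Hr Hv.
assert (Ht := tanh_pos v Hv).
replace (r * tanh v * _) with
  (r ^ 2 * tanh v + (1 - r) * (tanh v * (r * tanh (r * ln (cosh v))))
   - r * tanh (r * v)) by (unfold tanh_gap; field; lra).
apply is_derive_mean_gap.
Qed.

Lemma mean_gap_0 r : mean_gap r 0 = 0.
Proof.
unfold mean_gap; rewrite ln_cosh_0, !Rmult_0_r, ln_cosh_0; ring.
Qed.

Lemma continuous_mean_gap r v : continuous (mean_gap r) v.
Proof.
apply (ex_derive_continuous (V:=R_NormedModule)).
eexists; apply is_derive_mean_gap.
Qed.

Lemma ln_cosh_asymptotic v :
  ln (cosh v) = v - ln 2 + ln (1 + exp (- (2 * v))).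
Proof.
assert (H := exp_pos (- (2 * v))).
replace (cosh v) with (exp v / 2 * (1 + exp (- (2 * v)))).
- assert (Hv := exp_pos v). rewrite ln_mult, ln_div, ln_exp; lra.
- unfold cosh. replace (- v) with (v + - (2 * v)) by ring. rewrite exp_plus. field.
Qed.

Lemma ln_cosh_defect_small e : 0 < e ->
  exists V, 0 < V /\ forall v, V < v -> 0 <= ln (1 + exp (- (2 * v))) < e.
Proof.
intros He.
assert (HV : 0 < / e) by now apply Rinv_0_lt_compat.
exists (/ e); split; auto.
intros v Hv.
assert (H := exp_pos (- (2 * v))).
split.
- rewrite <- ln_1 at 1; apply ln_le; lra.
- apply (Rle_lt_trans _ (exp (- (2 * v)))).
  + rewrite <- (ln_exp (exp (- (2 * v)))) at 2. apply ln_le; [lra|apply exp_ineq1_le].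
  + rewrite exp_Ropp, <- (Rinv_inv e).
    apply Rinv_lt_contravar.
    * apply Rmult_lt_0_compat; [exact HV|apply exp_pos].
    * generalize (exp_ineq1_le (2 * v)); lra.
Qed.

(** Expanding each [ln (cosh z)] as [z - ln 2] plus a defect, all linear and constant terms
    cancel. *)
Lemma mean_gap_defect r v :
  mean_gap r v = r * ln (1 + exp (- (2 * v)))
    + (1 - r) * ln (1 + exp (- (2 * (r * ln (cosh v)))))
    - ln (1 + exp (- (2 * (r * v)))).
Proof.
unfold mean_gap.
rewrite (ln_cosh_asymptotic (r * ln (cosh v))), (ln_cosh_asymptotic (r * v)).
rewrite (ln_cosh_asymptotic v) at 1 2. ring.
Qed.

Lemma mean_gap_at_infinity r : 0 < r ->
  forall e, 0 < e -> exists V, forall v, V < v -> Rabs (mean_gap r v) < e.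
Proof.
intros Hr e He.
(* The defects have weights [r], [1 - r] and [-1], and [r + |1 - r| + 1 <= 2 + 2 r]. *)
assert (Hd : 0 < e / (2 + 2 * r)) by (apply Rdiv_lt_0_compat; lra).
destruct (ln_cosh_defect_small _ Hd) as [V [V0 HV]].
set (d := e / (2 + 2 * r)) in *.
assert (Ed : d * (2 + 2 * r) = e) by (unfold d; field; lra).
assert (HVr : 0 < V / r) by (apply Rdiv_lt_0_compat; lra).
(* Beyond this point [v], [r v] and [r (v - ln 2) < r ln (cosh v)] all exceed [V]. *)
exists (V + V / r + ln 2); intros v Hv.
assert (0 < ln 2) by (rewrite <- ln_1; apply ln_increasing; lra).
assert (E : r * (V / r) = V) by (field; lra).
assert (HA : v - ln 2 < ln (cosh v)).
{ rewrite ln_cosh_asymptotic.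
  assert (0 < ln (1 + exp (- (2 * v)))).
  { rewrite <- ln_1 at 1; apply ln_increasing; [lra|].
    generalize (exp_pos (- (2 * v))); lra. }
  lra. }
assert (H1 : V < v) by lra. assert (H2 : V < r * v) by nra.
assert (H3 : V < r * ln (cosh v)) by nra.
apply HV in H1. apply HV in H2. apply HV in H3.
rewrite mean_gap_defect.
apply Rabs_def1; nra.
Qed.

(** * Sign of [G] for positive [r] *)

(** Once negative, [g] would keep decreasing and so stay below a negative constant, against its
    limit [0]. *)
Lemma nonneg_of_stays_negative_derive (g k f : R -> R) :
  (forall v, 0 < v -> is_derive g v (k v * f v)) ->
  (forall v, 0 < v -> 0 < k v) ->
  continuous g 0 -> 0 <= g 0 ->
  stays_negative f ->
  (forall e, 0 < e -> exists V, forall v, V < v -> Rabs (g v) < e) ->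
  forall v, 0 < v -> 0 <= g v.
Proof.
intros Hd Hk Hc H0 Hf Hi v Hv.
destruct (Rle_lt_dec 0 (g v)) as [|Hn]; auto.
destruct (Hi (- g v)) as [V HV]; [lra|].
set (b := Rmax V v + 1).
assert (Hb : V < b /\ v < b) by (unfold b; generalize (Rmax_l V v) (Rmax_r V v); lra).
assert (g b < g v).
{ apply (decreasing_once_negative g k f); auto; [|lra].
  now apply ge_near_0_of_continuous. }
generalize (HV b (proj1 Hb)); intros Ha; apply Rabs_def2 in Ha; lra.
Qed.

(** As [1 - r > 0], the derivative of [G] has the sign of [log_gap r], which stays negative once
    negative. *)
Lemma mean_gap_nonneg_low r v : 0 < r <= / 2 -> 0 < v -> 0 <= mean_gap r v.
Proof.
intros Hr.
apply (nonneg_of_stays_negative_derive _ (fun v => r * tanh v)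
  (fun v => (1 - r) * (tanh (r * ln (cosh v)) - tanh_gap r v))).
- intros t Ht; apply is_derive_mean_gap_factored; lra.
- intros t Ht; apply Rmult_lt_0_compat; [lra|now apply tanh_pos].
- apply continuous_mean_gap.
- rewrite mean_gap_0; lra.
- intros a b ab Ha.
  assert (Ba : 0 < tanh_gap r a < 1) by (apply tanh_gap_bounds; lra).
  assert (Bb : 0 < tanh_gap r b < 1) by (apply tanh_gap_bounds; lra).
  assert (log_gap r a < 0) by (apply artanh_gap_sign; nra).
  assert (tanh (r * ln (cosh b)) < tanh_gap r b).
  { apply artanh_gap_sign; [lra|]. now apply (stays_negative_log_gap r Hr a b). }
  nra.
- apply mean_gap_at_infinity; lra.
Qed.

(** Now [log_gap r] stays positive once positive, so the argument applies to [- G]. *)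
Lemma mean_gap_nonpos_of_pos r v : / 2 < r < 1 -> 0 < v -> mean_gap r v <= 0.
Proof.
intros Hr Hv.
assert (0 <= - mean_gap r v); [|lra]. revert v Hv.
apply (nonneg_of_stays_negative_derive (fun v => - mean_gap r v) (fun v => r * tanh v)
  (fun v => (1 - r) * (tanh_gap r v - tanh (r * ln (cosh v))))).
- intros t Ht.
  replace (r * tanh t * _) with (- (r * tanh t * ((1 - r) * (tanh (r * ln (cosh t)) - tanh_gap r t)))) by ring.
  apply @is_derive_opp, is_derive_mean_gap_factored; lra.
- intros t Ht; apply Rmult_lt_0_compat; [lra|now apply tanh_pos].
- apply @continuous_opp, continuous_mean_gap.
- rewrite mean_gap_0; lra.
- intros a b ab Ha.
  assert (Ba : 0 < tanh_gap r a < 1) by (apply tanh_gap_bounds; lra).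
  assert (Bb : 0 < tanh_gap r b < 1) by (apply tanh_gap_bounds; lra).
  assert (0 < log_gap r a) by (apply artanh_gap_sign; nra).
  assert (tanh_gap r b < tanh (r * ln (cosh b))).
  { apply artanh_gap_sign; [lra|].
    assert (- log_gap r b < 0); [|unfold log_gap in *; lra].
    apply (stays_negative_opp_log_gap r) with a; lra. }
  nra.
- intros e He. destruct (mean_gap_at_infinity r) with (e := e) as [V HV]; [lra|easy|].
  exists V; intros; rewrite Rabs_Ropp; auto.
Qed.

(** The factor [1 - r] is negative here and reverses the sign once more. *)
Lemma mean_gap_nonneg_high r v : 1 < r -> 0 < v -> 0 <= mean_gap r v.
Proof.
intros Hr.
apply (nonneg_of_stays_negative_derive _ (fun v => r * tanh v)
  (fun v => (1 - r) * (tanh (r * ln (cosh v)) - tanh_gap r v))).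
- intros t Ht; apply is_derive_mean_gap_factored; lra.
- intros t Ht; apply Rmult_lt_0_compat; [lra|now apply tanh_pos].
- apply continuous_mean_gap.
- rewrite mean_gap_0; lra.
- intros a b ab Ha.
  assert (Ba : 0 < tanh_gap r a < 1) by (apply tanh_gap_bounds; lra).
  assert (Bb : 0 < tanh_gap r b < 1) by (apply tanh_gap_bounds; lra).
  assert (0 < log_gap r a) by (apply artanh_gap_sign; nra).
  assert (tanh_gap r b < tanh (r * ln (cosh b))).
  { apply artanh_gap_sign; [lra|].
    assert (- log_gap r b < 0); [|unfold log_gap in *; lra].
    apply (stays_negative_opp_log_gap r) with a; lra. }
  nra.
- apply mean_gap_at_infinity; lra.
Qed.

Lemma mean_gap_1 v : mean_gap 1 v = 0.
Proof. unfold mean_gap; rewrite !Rmult_1_l; ring. Qed.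

(** * Sign of [G] for negative [r] *)

Lemma nonneg_of_derive_nonneg (g g1 : R -> R) :
  (forall v, 0 < v -> is_derive g v (g1 v)) ->
  (forall v, 0 < v -> 0 <= g1 v) ->
  (forall e, 0 < e -> exists d, 0 < d /\ forall v, 0 < v < d -> - e < g v) ->
  forall v, 0 < v -> 0 <= g v.
Proof.
intros Hd Hp H0 v Hv.
destruct (Rle_lt_dec 0 (g v)) as [|Hn]; auto.
destruct (H0 (- g v)) as [d [d0 Hd0]]; [lra|].
set (x := Rmin (d / 2) (v / 2)).
assert (0 < x) by (unfold x; apply Rmin_glb_lt; lra).
assert (x < d /\ x < v) by (unfold x; generalize (Rmin_l (d/2) (v/2)) (Rmin_r (d/2) (v/2)); lra).
assert (- - g v < g x) by (apply Hd0; lra).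
assert (g x <= g v); [|lra].
apply (increasing_from_derive g g1); [lra| |].
- intros; apply Hd; lra.
- intros; apply Hp; lra.
Qed.

Lemma ln_cosh_scale_le_sqr r v :
  1 < r -> 0 < v -> ln (cosh (r * v)) <= r ^ 2 * ln (cosh v).
Proof.
intros Hr Hv.
assert (r ^ 2 * ln (cosh 0) - ln (cosh (r * 0)) <= r ^ 2 * ln (cosh v) - ln (cosh (r * v)));
  [|rewrite !Rmult_0_r, ln_cosh_0, Rmult_0_r in *; lra].
apply (increasing_from_derive (fun v => r ^ 2 * ln (cosh v) - ln (cosh (r * v)))
  (fun v => r ^ 2 * tanh v - r * tanh (r * v))); auto.
- intros c _; apply @is_derive_minus; [apply is_derive_scal, is_derive_ln_cosh|].
  apply is_derive_ln_cosh_scale.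
- intros c Hc. generalize (tanh_scale_lt r c Hr (proj1 Hc)); nra.
Qed.

(** Here [u] is the numerator of [tanh_gap], and the corresponding [artanh_gap] is nonnegative
    because its derivative is. *)
Lemma tanh_ratio_le_tanh r v : 0 < r < 1 -> 0 < v ->
  tanh (r * v) / tanh v - r <= tanh (r * ln (cosh v)).
Proof.
intros Hr.
set (u := fun v => tanh (r * v) / tanh v - r).
assert (Hw : forall v, 0 < v -> r * tanh v < tanh (r * v) < tanh v
   /\ 0 < tanh v /\ u v * tanh v = tanh (r * v) - r * tanh v).
{ intros t Ht. assert (H := tanh_pos t Ht).
  split; [split; [now apply tanh_scale_gt|apply tanh_lt; nra]|].
  split; auto. unfold u; field; lra. }
assert (Hu : forall v, 0 < v -> 0 < u v < 1 /\ u v <= cosh v - 1).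
{ intros t Ht. destruct (Hw t Ht) as [H1 [H2 H3]].
  split; [nra|].
  generalize (tanh_ratio_le r t (proj1 Hr) Ht) (cosh_ge_1 t); unfold u; nra. }
assert (HK : forall v, 0 < v -> 0 <= artanh_gap r u v).
{ apply nonneg_of_derive_nonneg with (g1 := fun v => 2 * r * tanh v - 2 *
    ((r * (1 - tanh (r * v) ^ 2) * tanh v - tanh (r * v) * (1 - tanh v ^ 2))
     / tanh v ^ 2) / (1 - u v ^ 2)).
  - intros t Ht. apply is_derive_artanh_gap; [|apply Hu, Ht].
    assert (D := is_derive_scal (tanh_gap r) t (1 - r) _ (is_derive_tanh_gap r t Ht ltac:(lra))).
    replace (_ / tanh t ^ 2) with ((1 - r) * ((r * (1 - tanh (r * t) ^ 2) * tanh t - tanh (r * t) * (1 - tanh t ^ 2))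
     / tanh t ^ 2 / (1 - r))).
    2: { field. generalize (tanh_pos t Ht); lra. }
    apply (is_derive_ext (fun v => (1 - r) * tanh_gap r v)); [|exact D].
    assert (E : forall z, (1 - r) * (z / (1 - r)) = z) by (intros; field; lra).
    intros x; apply E.
  - intros t Ht. destruct (Hw t Ht) as [H1 [H2 H3]]. destruct (Hu t Ht) as [H4 _].
    assert (Hq : 0 < 1 - u t ^ 2) by nra.
    set (h := tanh (r * t)) in *. set (s := tanh t) in *.
    replace (2 * r * s - _) with
     (2 * ((r * s * (s ^ 2 - (u t * s) ^ 2) - (r * (1 - h ^ 2) * s - h * (1 - s ^ 2))) / (s ^ 2 * (1 - u t ^ 2)))).
    2: { field. split; nra. }
    apply Rmult_le_pos; [lra|]. apply Rmult_le_pos.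
    2: { apply Rlt_le, Rinv_0_lt_compat, Rmult_lt_0_compat; nra. }
    rewrite H3.
    assert (Hs := tanh_sqr_lt_1 t). fold s in Hs.
    (* Visibly nonnegative, since [h > r s] and [s^2 < 1]. *)
    replace (_ - _) with ((h - r * s) * (1 - s ^ 2 + 2 * r ^ 2 * s ^ 2) + r ^ 3 * s ^ 3) by ring.
    apply Rplus_le_le_0_compat; [apply Rmult_le_pos; nra|].
    apply Rmult_le_pos; apply pow_le; lra.
  - apply artanh_gap_near_0; [lra|easy]. }
intros Hv. change (u v <= tanh (r * ln (cosh v))).
destruct (Rle_lt_dec (u v) (tanh (r * ln (cosh v)))) as [|Hn]; auto.
assert (artanh_gap r u v < 0); [|generalize (HK v Hv); lra].
apply artanh_gap_sign; auto. generalize (Hu v Hv); lra.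
Qed.

(** For [r < 1] the difference of the sides has derivative [r tanh v] times the gap in
    [tanh_ratio_le_tanh]; for [r >= 1] the first term on the right already suffices. *)
Lemma ln_cosh_scale_le r v : 0 < r -> 0 < v ->
  ln (cosh (r * v)) <= r ^ 2 * ln (cosh v) + ln (cosh (r * ln (cosh v))).
Proof.
intros Hr Hv.
destruct (Rlt_dec r 1) as [H|H].
- assert (r ^ 2 * ln (cosh 0) + ln (cosh (r * ln (cosh 0))) - ln (cosh (r * 0))
    <= r ^ 2 * ln (cosh v) + ln (cosh (r * ln (cosh v))) - ln (cosh (r * v))).
  2: { rewrite ln_cosh_0, !Rmult_0_r, ln_cosh_0 in *; lra. }
  apply (increasing_from_derive (fun v => r ^ 2 * ln (cosh v) + ln (cosh (r * ln (cosh v))) - ln (cosh (r * v)))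
    (fun v => r ^ 2 * tanh v + tanh v * (r * tanh (r * ln (cosh v))) - r * tanh (r * v))); auto.
  + intros c _. apply @is_derive_minus; [apply @is_derive_plus|].
    * apply is_derive_scal, is_derive_ln_cosh.
    * apply is_derive_ln_cosh_comp.
    * apply is_derive_ln_cosh_scale.
  + intros c Hc.
    assert (Ht := tanh_pos c (proj1 Hc)).
    assert (Hw := tanh_ratio_le_tanh r c (conj Hr H) (proj1 Hc)).
    replace (_ - _) with (r * tanh c * (tanh (r * ln (cosh c)) - (tanh (r * c) / tanh c - r))) by (field; lra).
    apply Rmult_le_pos; [apply Rmult_le_pos|]; lra.
- assert (H0 := ln_cosh_ge_0 (r * ln (cosh v))).
  destruct (Req_dec r 1) as [->|H1]; [rewrite !Rmult_1_l in *; lra|].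
  generalize (ln_cosh_scale_le_sqr r v); lra.
Qed.

Lemma cosh_opp v : cosh (- v) = cosh v.
Proof. unfold cosh; rewrite Ropp_involutive; lra. Qed.

(** [cosh] is even, so the bound for [- r] applies; the coefficient [1 - r] exceeds [1] and
    multiplies a nonnegative logarithm. *)
Lemma mean_gap_nonneg_neg r v : r < 0 -> 0 < v -> 0 <= mean_gap r v.
Proof.
intros Hr Hv; unfold mean_gap.
assert (H := ln_cosh_scale_le (- r) v ltac:(lra) Hv).
assert (H0 := ln_cosh_ge_0 (r * ln (cosh v))).
rewrite !Ropp_mult_distr_l_reverse, !cosh_opp in H. nra.
Qed.

Lemma mean_gap_opp r v : mean_gap r (- v) = mean_gap r v.
Proof.
unfold mean_gap; now rewrite Ropp_mult_distr_r_reverse, !cosh_opp.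
Qed.

Lemma mean_gap_nonneg r v : r < 0 \/ 0 < r <= / 2 \/ 1 <= r -> 0 <= mean_gap r v.
Proof.
intros Hr.
assert (H : forall v, 0 < v -> 0 <= mean_gap r v).
{ intros t Ht. destruct Hr as [Hr|[Hr|Hr]].
  - now apply mean_gap_nonneg_neg.
  - now apply mean_gap_nonneg_low.
  - destruct Hr as [Hr|<-]; [now apply mean_gap_nonneg_high|rewrite mean_gap_1; lra]. }
destruct (Rtotal_order v 0) as [Hv|[->|Hv]]; auto.
- rewrite <- mean_gap_opp; apply H; lra.
- rewrite mean_gap_0; lra.
Qed.

Lemma mean_gap_nonpos r v : / 2 < r < 1 -> mean_gap r v <= 0.
Proof.
intros Hr.
destruct (Rtotal_order v 0) as [Hv|[->|Hv]]; [| |now apply mean_gap_nonpos_of_pos].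
- rewrite <- mean_gap_opp; apply mean_gap_nonpos_of_pos; lra.
- rewrite mean_gap_0; lra.
Qed.

(** * Power means in exponential form, and the conclusion *)

(** With [c] the mean of the logarithms and [v = p (ln x - ln y) / 2], the powers are
    [exp (p c + v)] and [exp (p c - v)], of mean [exp (p c) cosh v]. *)
Lemma power_mean_exp p x y : 0 < x -> 0 < y -> p <> 0 ->
  power_mean p x y =
  exp ((ln x + ln y) / 2 + / p * ln (cosh (p * (ln x - ln y) / 2))).
Proof.
intros Hx Hy Hp; unfold power_mean.
destruct (Req_EM_T p 0) as [E|_]; [now elim Hp|].
unfold Rpower at 1; f_equal.
replace ((Rpower x p + Rpower y p) / 2)
  with (exp (p * ((ln x + ln y) / 2)) * cosh (p * (ln x - ln y) / 2)).
- rewrite ln_mult, ln_exp by (try apply exp_pos; apply cosh_pos). field; lra.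
- unfold Rpower, cosh.
  replace (p * ln x) with (p * ((ln x + ln y) / 2) + p * (ln x - ln y) / 2) by field.
  replace (p * ln y) with (p * ((ln x + ln y) / 2) + - (p * (ln x - ln y) / 2)) by field.
  rewrite !exp_plus; field.
Qed.

(** The means of order [p] and [- p] are [exp (c + A / p)] and [exp (c - A / p)] with
    [A = ln (cosh v)], so their half-sum is [exp c cosh (A / p)]. *)
Lemma power_mean_sides p x y : 0 < x -> 0 < y -> p <> 0 ->
  exists m v,
  Rpower (power_mean 1 x y) p = exp m /\
  Rpower ((power_mean p x y + power_mean (- p) x y) / 2) (p - 1) * power_mean p x y
  = exp (m + p * mean_gap (/ p) v).
Proof.
intros Hx Hy Hp.
rewrite !power_mean_exp by lra.
set (c := (ln x + ln y) / 2).
set (v := p * (ln x - ln y) / 2).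
replace (1 * (ln x - ln y) / 2) with (/ p * v) by (unfold v; field; lra).
replace (- p * (ln x - ln y) / 2) with (- v) by (unfold v; field).
rewrite cosh_opp, Rinv_1, Rmult_1_l.
exists (p * (c + ln (cosh (/ p * v)))), v.
split; [unfold Rpower; now rewrite ln_exp|].
replace ((exp (c + / p * ln (cosh v)) + exp (c + / - p * ln (cosh v))) / 2)
  with (exp c * cosh (/ p * ln (cosh v))).
2: { replace (/ - p * ln (cosh v)) with (- (/ p * ln (cosh v))) by (field; lra).
  rewrite !exp_plus; unfold cosh at 1; field. }
unfold Rpower. rewrite ln_mult, ln_exp by (try apply exp_pos; apply cosh_pos).
rewrite <- exp_plus; f_equal.
unfold mean_gap; field; lra.
Qed.

Theorem corollary1p4 :
  (forall x y p : R, 0 < x -> 0 < y -> (0 <= p <= 1 \/ 2 <= p) ->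
     Rpower (power_mean 1 x y) p <=
     Rpower ((power_mean p x y + power_mean (- p) x y) / 2) (p - 1)
       * power_mean p x y)
  /\
  (forall x y p : R, 0 < x -> 0 < y -> (p < 0 \/ 1 < p < 2) ->
     Rpower (power_mean 1 x y) p >=
     Rpower ((power_mean p x y + power_mean (- p) x y) / 2) (p - 1)
       * power_mean p x y).
Proof.
assert (Hexp : forall a b, a <= b -> exp a <= exp b).
{ intros a b [H| ->]; [left; now apply exp_increasing|apply Rle_refl]. }
split; intros x y p Hx Hy Hp.
(* At [p = 0] all means on the right are [sqrt (x y)] and both sides equal [1]. *)
- destruct (Req_dec p 0) as [->|Hp0].
  { assert (0 < sqrt (x * y)) by (apply sqrt_lt_R0, Rmult_lt_0_compat; auto).
    rewrite Ropp_0. unfold power_mean at 2 3 4.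
    destruct (Req_EM_T 0 0) as [_|[]]; [|easy].
    replace ((sqrt (x * y) + sqrt (x * y)) / 2) with (sqrt (x * y)) by field.
    replace (0 - 1) with (- (1)) by ring.
    rewrite Rpower_Ropp, Rpower_1, Rinv_l by lra.
    unfold Rpower; rewrite Rmult_0_l, exp_0; lra. }
  destruct (power_mean_sides p x y Hx Hy Hp0) as [m [v [-> ->]]].
  apply Hexp.
  (* [0 < p <= 1] becomes [1 <= r], and [2 <= p] becomes [0 < r <= 1/2]. *)
  assert (0 <= mean_gap (/ p) v); [|nra].
  apply mean_gap_nonneg; right.
  destruct Hp as [Hp|Hp]; [right|left; split].
  + rewrite <- Rinv_1; apply Rinv_le_contravar; lra.
  + apply Rinv_0_lt_compat; lra.
  + apply Rinv_le_contravar; lra.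
- assert (Hp0 : p <> 0) by lra.
  destruct (power_mean_sides p x y Hx Hy Hp0) as [m [v [-> ->]]].
  apply Rle_ge, Hexp.
  destruct Hp as [Hp|Hp].
  (* [G] is nonnegative here too; it is the negative factor [p] that reverses the inequality. *)
  + assert (0 <= mean_gap (/ p) v); [|nra].
    apply mean_gap_nonneg; left; now apply Rinv_lt_0_compat.
  + assert (mean_gap (/ p) v <= 0); [|nra].
    apply mean_gap_nonpos; split; [|rewrite <- Rinv_1]; apply Rinv_lt_contravar; lra.
Qed.
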